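(* Let $ABC$ be a nondegenerate triangle without right angle, with $a=|BC|$, $b=|CA|$, $c=|AB|$ and area $S$. Let $DEF$ be the triangle formed by the tangents to the circumcircle of $ABC$ at $A,B,C$, where $D$ is the intersection of the tangents at $B$ and $C$, $E$ that of the tangents at $C$ and $A$, and $F$ that of the tangents at $A$ and $B$. Let $|EF|,|FD|,|DE|$ denote the signed side lengths $$|EF|=\frac{a^3bc}{2S_BS_C},\qquad |FD|=\frac{ab^3c}{2S_AS_C},\qquad |DE|=\frac{abc^3}{2S_AS_B}.$$ Let $x,y,z$ be real numbers such that $\mu=\frac{a^2x}{|EF|}+\frac{b^2y}{|FD|}+\frac{c^2z}{|DE|}\neq0$, and let $$P=\mu^{-1}\left(\frac{yb^2}{|FD|}D+\frac{zc^2}{|DE|}E+\frac{xa^2}{|EF|}F\right),\qquad Q=\mu^{-1}\left(\frac{zc^2}{|DE|}D+\frac{xa^2}{|EF|}E+\frac{yb^2}{|FD|}F\right).$$ Then $$\left(xa^2+yb^2+zc^2\right)^2-16S^2(yz+zx+xy)=\mu^2|PQ|^2\ \ge\ 0 .$$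
   Context: Conway notation: $S_A=\frac12(b^2+c^2-a^2)$, $S_B=\frac12(c^2+a^2-b^2)$, $S_C=\frac12(a^2+b^2-c^2)$. When $ABC$ is acute the quantities $|EF|,|FD|,|DE|$ are the ordinary side lengths of $DEF$; when $ABC$ is obtuse some of them are negative, as given by the formulas. $P$ and $Q$ are affine combinations of $D,E,F$ (weights summing to $1$), and $|PQ|$ is the ordinary distance. *)

(* Defs.v *)
From mathcomp Require Import all_boot all_order all_algebra reals.

Set Implicit Arguments.
Unset Strict Implicit.
Unset Printing Implicit Defensive.

Import Order.TTheory GRing.Theory Num.Theory.
Local Open Scope ring_scope.

(* The Euclidean plane is 'rV[R]_2. *)

Definition dot (R : realType) (u v : 'rV[R]_2) : R :=
  \sum_(i < 2) u 0 i * v 0 i.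

Definition dist (R : realType) (A B : 'rV[R]_2) : R :=
  Num.sqrt (dot (B - A) (B - A)).

Definition cross (R : realType) (u v : 'rV[R]_2) : R :=
  u 0 0 * v 0 1 - u 0 1 * v 0 0.

Definition area (R : realType) (A B C : 'rV[R]_2) : R :=
  `|cross (B - A) (C - A)| / 2.

Definition nondegenerate_triangle (R : realType) (A B C : 'rV[R]_2) : Prop :=
  cross (B - A) (C - A) != 0.

(* The angle at the vertex [A] of the triangle [A B C]. *)
Definition right_angle (R : realType) (A B C : 'rV[R]_2) : Prop :=
  dot (B - A) (C - A) = 0.

Definition circumcenter (R : realType) (O A B C : 'rV[R]_2) : Prop :=
  dist O A = dist O B /\ dist O B = dist O C.

(* [X] lies on the tangent at [T] to the circle with centre [O] through [T]:
   the line through [T] perpendicular to the radius [O T]. *)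
Definition on_tangent (R : realType) (O T X : 'rV[R]_2) : Prop :=
  dot (X - T) (T - O) = 0.

(* With a, b, c the side lengths,
   S_A = conway a b c, S_B = conway b c a, S_C = conway c a b. *)
Definition conway (R : realType) (a b c : R) : R :=
  (b ^+ 2 + c ^+ 2 - a ^+ 2) / 2.

(* Main.v *)
Require Import Defs.
From mathcomp Require Import all_boot all_order all_algebra reals.
From mathcomp Require Import ring lra.

Set Implicit Arguments.
Unset Strict Implicit.
Unset Printing Implicit Defensive.

Import Order.TTheory GRing.Theory Num.Theory.
Local Open Scope ring_scope.

(* Write J for the rotation by a right angle and T for twice the signed area of
   ABC.  The side of the tangential triangle through A is orthogonal to A - O,
   and in fact F - E = |EF| (2T/abc) J(A - O), with the signed length |EF|.
   Hence mu (P - Q), which is the sum of (x a^2/|EF|) (F - E) and its cyclic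
   analogues, equals (2T/abc) J(W) with
   W = x a^2 (A - O) + y b^2 (B - O) + z c^2 (C - O).  Leibniz' formula for the
   norm of W and 4 T^2 |A - O|^2 = (abc)^2 give the identity. *)

Definition rot (R : realType) (u : 'rV[R]_2) : 'rV[R]_2 :=
  \row_(i < 2) (if i == 0 then - u 0 1 else u 0 0).

Section Plane.

Variable R : realType.
Implicit Types (u v w A B C O E F : 'rV[R]_2) (k l m x : R).

Lemma dotE u v : dot u v = u 0 0 * v 0 0 + u 0 1 * v 0 1.
Proof.
rewrite /dot big_ord_recl big_ord1.
by have -> : lift ord0 ord0 = 1 :> 'I_2 by apply: val_inj.
Qed.

Lemma rot0 u : rot u 0 0 = - u 0 1. Proof. by rewrite mxE. Qed.
Lemma rot1 u : rot u 0 1 = u 0 0. Proof. by rewrite mxE. Qed.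

Lemma row2P u v : u 0 0 = v 0 0 -> u 0 1 = v 0 1 -> u = v.
Proof.
move=> h0 h1; apply/rowP => i; have [->|->] // : i = 0 \/ i = 1.
by case: i => [[|[|n]] //= lti]; [left | right]; apply: val_inj.
Qed.

Definition coordE := (dotE, rot0, rot1, mxE).

Lemma dot_ge0 u : 0 <= dot u u.
Proof. by rewrite dotE addr_ge0 // -expr2 sqr_ge0. Qed.

Lemma dot_eq0 u : (dot u u == 0) = (u == 0).
Proof.
apply/eqP/eqP => [|->]; last by rewrite !coordE !mul0r addr0.
rewrite dotE => h; have h0 := sqr_ge0 (u 0 0); have h1 := sqr_ge0 (u 0 1).
by apply: row2P; rewrite mxE; apply/eqP; rewrite -sqrf_eq0; apply/eqP; lra.
Qed.

Lemma dist_sqr A B : dist A B ^+ 2 = dot (B - A) (B - A).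
Proof. by rewrite sqr_sqrtr ?dot_ge0. Qed.

Lemma dist_neq0 A B : (dist A B != 0) = (A != B).
Proof. by rewrite -sqrf_eq0 dist_sqr dot_eq0 subr_eq0 eq_sym. Qed.

(** The law of cosines. It identifies the denominators of the signed lengths with the dot products
    that vanish exactly at right angles. *)
Lemma conway_dot A B C :
  conway (dist B C) (dist C A) (dist A B) = dot (B - A) (C - A).
Proof. by rewrite /conway !dist_sqr !coordE; field. Qed.

Lemma cross_cycle A B C : cross (C - B) (A - B) = cross (B - A) (C - A).
Proof. by rewrite /cross !coordE; ring. Qed.

Lemma cross_neq0 A B C : cross (B - A) (C - A) != 0 -> A != B.
Proof. by apply: contraNneq => ->; rewrite /cross !coordE; apply/eqP; ring. Qed.

Lemma dot_rot u : dot (rot u) (rot u) = dot u u.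
Proof. by rewrite !coordE; ring. Qed.

(** Cramer's rule: [e0] and [e1] solve for the coordinates of [h] from its products with two
    independent vectors. *)
Lemma dot_cross_eq0 (w u h : 'rV[R]_2) :
  cross w u != 0 -> dot h w = 0 -> dot h u = 0 -> h = 0.
Proof.
move=> wu0 hw hu.
have e0 : cross w u * h 0 0 = u 0 1 * dot h w - w 0 1 * dot h u.
  by rewrite /cross !dotE; ring.
have e1 : cross w u * h 0 1 = w 0 0 * dot h u - u 0 0 * dot h w.
  by rewrite /cross !dotE; ring.
by apply: row2P; rewrite mxE; apply: (mulfI wu0);
  rewrite ?e0 ?e1 hw hu !mulr0 subrr.
Qed.

(** The Binet-Cauchy identity in the plane. It expresses the oriented position of O relative to AB
    through dot products alone, so that no sign is lost. *)
Lemma cross_mul (w u v : 'rV[R]_2) :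
  cross u v * cross w u = dot u w * dot v u - dot u u * dot v w.
Proof. by rewrite /cross !dotE; ring. Qed.

Lemma equidistant_dot A B O :
  dot (A - O) (A - O) = dot (B - O) (B - O) ->
  dot (B - A) (O - A) = dot (B - A) (B - A) / 2.
Proof. rewrite !coordE => h; lra. Qed.

(** Both sides have the same dot products with the independent vectors [O - A] and [B - A], hence
    are equal. Clearing the denominator S_C keeps the signs right for obtuse triangles too. *)
Lemma tangents_meet A B C O F :
  cross (B - A) (C - A) != 0 -> dot (A - C) (B - C) != 0 ->
  dot (A - O) (A - O) = dot (B - O) (B - O) ->
  dot (A - O) (A - O) = dot (C - O) (C - O) ->
  on_tangent O A F -> on_tangent O B F ->
  dot (A - C) (B - C) *: (F - A) = cross (B - A) (C - A) *: rot (A - O).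
Proof.
move=> T0 SC0 hB hC tA tB.
have uu0 : dot (B - A) (B - A) != 0.
  by rewrite dot_eq0 subr_eq0 eq_sym (cross_neq0 T0).
have hu := equidistant_dot hB; have hv := equidistant_dot hC.
have hT : cross (B - A) (C - A) * cross (O - A) (B - A)
        = - (dot (A - C) (B - C) * dot (B - A) (B - A) / 2).
  by rewrite cross_mul hu hv !coordE; field.
(* Since the angle at C is not right, O is off the line AB, and the tangents at A and B are not
   parallel. *)
have wu0 : cross (O - A) (B - A) != 0.
  apply: contraNneq (mulf_neq0 SC0 uu0) => h0.
  by move: hT; rewrite h0 mulr0 => hT; apply/eqP; lra.
have gw : dot (F - A) (O - A) = 0.
  by move: tA; rewrite /on_tangent !coordE => tA; lra.
(* F, like O, projects to the midpoint of AB. *)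
have gu : dot (F - A) (B - A) = dot (B - A) (B - A) / 2.
  by move: tB gw hu; rewrite /on_tangent !coordE => tB gw hu; lra.
apply/eqP; rewrite -subr_eq0; apply/eqP; apply: (dot_cross_eq0 wu0).
  transitivity (dot (A - C) (B - C) * dot (F - A) (O - A)).
    by rewrite !coordE; ring.
  by rewrite gw mulr0.
transitivity (dot (A - C) (B - C) * dot (F - A) (B - A)
              + cross (B - A) (C - A) * cross (O - A) (B - A)).
  by rewrite /cross !coordE; ring.
by rewrite hT gu; field.
Qed.

(** E arises from F by exchanging B and C, which reverses the sign of T. Subtracting gives the
    coefficient T/S_C + T/S_B, and S_B + S_C = a^2. *)
Lemma tangential_side A B C O E F :
  cross (B - A) (C - A) != 0 ->
  dot (C - B) (A - B) != 0 -> dot (A - C) (B - C) != 0 ->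
  dot (A - O) (A - O) = dot (B - O) (B - O) ->
  dot (A - O) (A - O) = dot (C - O) (C - O) ->
  on_tangent O C E /\ on_tangent O A E ->
  on_tangent O A F /\ on_tangent O B F ->
  F - E = (cross (B - A) (C - A) * dist B C ^+ 2
           / (dot (C - B) (A - B) * dot (A - C) (B - C))) *: rot (A - O).
Proof.
move=> T0 SB0 SC0 hB hC [tCE tAE] [tAF tBF].
have hF := tangents_meet T0 SC0 hB hC tAF tBF.
have swapT : cross (C - A) (B - A) = - cross (B - A) (C - A).
  by rewrite /cross; ring.
have dotC : dot (A - B) (C - B) = dot (C - B) (A - B) by rewrite !dotE; ring.
have hE : dot (C - B) (A - B) *: (E - A)
        = - cross (B - A) (C - A) *: rot (A - O).
  by rewrite -swapT -dotC; apply: tangents_meet; rewrite ?swapT ?oppr_eq0 ?dotC.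
have -> : dist B C ^+ 2 = dot (C - B) (A - B) + dot (A - C) (B - C).
  by rewrite dist_sqr !coordE; ring.
have -> : F - E = (F - A) - (E - A) by rewrite opprB addrA subrK.
rewrite -[F - A](scalerK SC0) -[E - A](scalerK SB0) hE hF !scalerA -scalerBl.
by congr (_ *: _); field; rewrite SB0 SC0.
Qed.

(** Dividing by the signed length cancels S_B S_C, leaving a factor 2T/(abc) that is the same for
    all three sides. *)
Lemma weighted_tangential_side A B C O E F x :
  cross (B - A) (C - A) != 0 ->
  ~ right_angle B C A -> ~ right_angle C A B ->
  dot (A - O) (A - O) = dot (B - O) (B - O) ->
  dot (A - O) (A - O) = dot (C - O) (C - O) ->
  on_tangent O C E /\ on_tangent O A E ->
  on_tangent O A F /\ on_tangent O B F ->
  let a := dist B C in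
  let b := dist C A in
  let c := dist A B in
  (x * a ^+ 2 / (a ^+ 3 * b * c / (2 * conway b c a * conway c a b)))
    *: (F - E)
  = (2 * cross (B - A) (C - A) / (a * b * c) * (x * a ^+ 2)) *: rot (A - O).
Proof.
move=> T0 /eqP SB0 /eqP SC0 hB hC tE tF a b c.
rewrite /right_angle in SB0 SC0.
rewrite (tangential_side T0 SB0 SC0 hB hC tE tF) scalerA !conway_dot.
have c0 : c != 0 by rewrite dist_neq0 (cross_neq0 T0).
have a0 : a != 0 by rewrite dist_neq0 (@cross_neq0 _ _ A) // cross_cycle.
have b0 : b != 0 by rewrite dist_neq0 (@cross_neq0 _ _ B) // 2!cross_cycle.
by congr (_ *: _); rewrite -/a; field; rewrite SB0 SC0 a0 b0 c0.
Qed.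

(** This is R = abc/(4S), squared. [gram] says that the Gram determinant of three plane vectors
    vanishes; it is applied to B - A, C - A and O - A. *)
Lemma circumradius_sqr A B C O :
  dot (A - O) (A - O) = dot (B - O) (B - O) ->
  dot (A - O) (A - O) = dot (C - O) (C - O) ->
  4 * cross (B - A) (C - A) ^+ 2 * dot (A - O) (A - O)
  = (dist B C * dist C A * dist A B) ^+ 2.
Proof.
move=> /equidistant_dot hu /equidistant_dot hv.
rewrite !exprMn !dist_sqr.
have gram (u v w : 'rV[R]_2) : cross u v ^+ 2 * dot w w
    = dot u w ^+ 2 * dot v v + dot v w ^+ 2 * dot u u
      - 2 * dot u w * dot v w * dot u v.
  by rewrite /cross !dotE; ring.
have -> : dot (A - O) (A - O) = dot (O - A) (O - A) by rewrite !coordE; ring.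
by rewrite -mulrA gram hu hv !coordE; field.
Qed.

(** Expand and replace each 2 u.v by |u|^2 + |v|^2 - |u - v|^2. *)
Lemma leibniz_dot (u v w : 'rV[R]_2) (k l m : R) :
  let W := k *: u + l *: v + m *: w in
  dot W W = (k + l + m) * (k * dot u u + l * dot v v + m * dot w w)
    - (k * l * dot (u - v) (u - v) + l * m * dot (v - w) (v - w)
       + m * k * dot (w - u) (w - u)).
Proof. by rewrite /= !coordE; ring. Qed.

End Plane.

Theorem mainTheorem7 (R : realType) (A B C O D E F : 'rV[R]_2) (x y z : R)
    (hABC : nondegenerate_triangle A B C)
    (hA : ~ right_angle A B C) (hB : ~ right_angle B C A)
    (hC : ~ right_angle C A B)
    (hO : circumcenter O A B C)
    (hD : on_tangent O B D /\ on_tangent O C D)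
    (hE : on_tangent O C E /\ on_tangent O A E)
    (hF : on_tangent O A F /\ on_tangent O B F) :
  let a := dist B C in
  let b := dist C A in
  let c := dist A B in
  let S := area A B C in
  let SA := conway a b c in
  let SB := conway b c a in
  let SC := conway c a b in
  let EF := a ^+ 3 * b * c / (2 * SB * SC) in
  let FD := a * b ^+ 3 * c / (2 * SA * SC) in
  let DE := a * b * c ^+ 3 / (2 * SA * SB) in
  let mu := a ^+ 2 * x / EF + b ^+ 2 * y / FD + c ^+ 2 * z / DE in
  let P := mu^-1 *: ((y * b ^+ 2 / FD) *: D + (z * c ^+ 2 / DE) *: E
                     + (x * a ^+ 2 / EF) *: F) in
  let Q := mu^-1 *: ((z * c ^+ 2 / DE) *: D + (x * a ^+ 2 / EF) *: E
                     + (y * b ^+ 2 / FD) *: F) in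
  mu != 0 ->
  (x * a ^+ 2 + y * b ^+ 2 + z * c ^+ 2) ^+ 2
    - 16 * S ^+ 2 * (y * z + z * x + x * y) = mu ^+ 2 * dist P Q ^+ 2
  /\ 0 <= mu ^+ 2 * dist P Q ^+ 2.
Proof.
move=> a b c S SA SB SC EF FD DE mu P Q mu0.
split; last by rewrite mulr_ge0 ?sqr_ge0.
have [hAB hBC] : dot (A - O) (A - O) = dot (B - O) (B - O)
    /\ dot (B - O) (B - O) = dot (C - O) (C - O).
  by case: hO => h1 h2; rewrite -!dist_sqr h1 h2.
have hAC := etrans hAB hBC.
rewrite /nondegenerate_triangle in hABC.
set T := cross (B - A) (C - A) in hABC.
have T1 : cross (C - B) (A - B) = T by rewrite cross_cycle.
have T2 : cross (A - C) (B - C) = T by rewrite 2!cross_cycle.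
have a0 : a != 0 by rewrite dist_neq0 (@cross_neq0 _ _ _ A) ?T1.
have b0 : b != 0 by rewrite dist_neq0 (@cross_neq0 _ _ _ B) ?T2.
have c0 : c != 0 by rewrite dist_neq0 (cross_neq0 hABC).
have sA := weighted_tangential_side x hABC hB hC hAB hAC hE hF.
have sB : (y * b ^+ 2 / FD) *: (D - F)
    = (2 * T / (a * b * c) * (y * b ^+ 2)) *: rot (B - O).
  have := @weighted_tangential_side _ B C A O F D y.
  cbv zeta; rewrite T1 -/a -/b -/c -/SA -/SC => /(_ hABC hC hA hBC (esym hAB) hF hD).
  have -> : b ^+ 3 * c * a / (2 * SC * SA) = FD.
    by rewrite /FD; congr (_ / _); ring.
  by have -> : b * c * a = a * b * c by ring.
have sC : (z * c ^+ 2 / DE) *: (E - D)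
    = (2 * T / (a * b * c) * (z * c ^+ 2)) *: rot (C - O).
  have := @weighted_tangential_side _ C A B O D E z.
  cbv zeta; rewrite T2 -/a -/b -/c -/SA -/SB
    => /(_ hABC hA hB (esym hAC) (esym hBC) hD hE).
  have -> : c ^+ 3 * a * b / (2 * SA * SB) = DE.
    by rewrite /DE; congr (_ / _); ring.
  by have -> : c * a * b = a * b * c by ring.
cbv zeta in sA; rewrite -/a -/b -/c -/SB -/SC -/EF -/T in sA.
pose W := (x * a ^+ 2) *: (A - O) + (y * b ^+ 2) *: (B - O)
          + (z * c ^+ 2) *: (C - O).
have PQ : mu *: (P - Q) = (2 * T / (a * b * c)) *: rot W.
  transitivity ((x * a ^+ 2 / EF) *: (F - E) + (y * b ^+ 2 / FD) *: (D - F)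
                + (z * c ^+ 2 / DE) *: (E - D)).
    rewrite /P /Q -scalerBr scalerA divff // scale1r.
    (* With the weights as indeterminates, regrouping by weight is a linear identity: P and Q attach
       each weight to two different vertices. *)
    move: (_ / EF) (_ / FD) (_ / DE) => p q r.
    by apply: row2P; rewrite !coordE; ring.
  by rewrite sA sB sC; apply: row2P; rewrite !coordE; ring.
have -> : mu ^+ 2 * dist P Q ^+ 2 = dot (mu *: (P - Q)) (mu *: (P - Q)).
  by rewrite dist_sqr; move: (P) (Q) => P' Q'; rewrite !coordE; ring.
have dotZ k (u : 'rV[R]_2) : dot (k *: u) (k *: u) = k ^+ 2 * dot u u.
  by rewrite !coordE; ring.
(* All three radii become |A - O|, so the first Leibniz term is R^2 times the square of the sum of
   the weights. *)
rewrite PQ dotZ dot_rot leibniz_dot -hBC -hAB.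
have dA : dot ((A - O) - (B - O)) ((A - O) - (B - O)) = c ^+ 2.
  by rewrite dist_sqr !coordE; ring.
have dB : dot ((B - O) - (C - O)) ((B - O) - (C - O)) = a ^+ 2.
  by rewrite dist_sqr !coordE; ring.
have dC : dot ((C - O) - (A - O)) ((C - O) - (A - O)) = b ^+ 2.
  by rewrite dist_sqr !coordE; ring.
rewrite dA dB dC.
have T20 : 4 * T ^+ 2 != 0 by rewrite mulf_neq0 ?pnatr_eq0 ?expf_neq0.
have -> : dot (A - O) (A - O) = (a * b * c) ^+ 2 / (4 * T ^+ 2).
  by rewrite -(circumradius_sqr hAB hAC) mulrC mulKf.
have -> : S ^+ 2 = T ^+ 2 / 4.
  by rewrite /S /area -/T expr_div_n real_normK ?num_real // -natrX.
(* The prefactor 4T^2/(abc)^2 cancels R^2 in the first term. Each product such as xa^2 yb^2 c^2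
   contains (abc)^2, which leaves 4T^2 = 16S^2. *)
by field; rewrite hABC a0 b0 c0.
Qed.
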